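(* Let $d\in\mathbb{Z}_{\ge2}$ and let $(\mathbf{R},\le)$ be an ordered field satisfying $[\mathrm{IVT}]_{d^2}$. Let $a,b\in\mathbf{R}$ and $P,Q\in\mathbf{R}[X]$ with $\deg P,\deg Q\le d^2$ and such that $P$ and $Q$ have no common root in $[a,b]$. Then $$\mathrm{Ind}_a^b(Q,P)+\mathrm{Ind}_a^b(P,Q)=\mathrm{Var}_a^b(P,Q).$$
   Context: For $n\in\mathbb{Z}_{\ge1}$, $[\mathrm{IVT}]_n$ is the property of an ordered field $(\mathbf{R},\le)$: for every $F\in\mathbf{R}[X]$ with $\deg F\le n$ and every $a<b$ in $\mathbf{R}$ with $F(a)F(b)<0$, there is $c\in\mathbf{R}$ with $a<c<b$ and $F(c)=0$. When $a>b$, $[a,b]$ denotes the closed interval with endpoints $a$ and $b$. $\mathrm{sign}(x)\in\{-1,0,1\}$ is the sign of $x\in\mathbf{R}$. For $P,Q\in\mathbf{R}[X]$, $\mathrm{Var}_x(P,Q)=\frac12|\mathrm{sign}(P(x))-\mathrm{sign}(Q(x))|$ and $\mathrm{Var}_a^b(P,Q)=\mathrm{Var}_a(P,Q)-\mathrm{Var}_b(P,Q)$. Cauchy index: for $x\in\mathbf{R}$ and $P,Q\in\mathbf{R}[X]\setminus\{0\}$ write uniquely $P=(X-x)^{\mu(x)}\widetilde P$, $Q=(X-x)^{\nu(x)}\widetilde Q$ with $\mu(x),\nu(x)\in\mathbb{Z}_{\ge0}$, $\widetilde P(x)\ne0$, $\widetilde Q(x)\neq0$. Put $\mathrm{Ind}_x^{+}(Q,P)=\frac12\mathrm{sign}(\widetilde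 Q(x)\widetilde P(x))$ and $\mathrm{Ind}_x^{-}(Q,P)=\frac12(-1)^{\mu(x)-\nu(x)}\mathrm{sign}(\widetilde Q(x)\widetilde P(x))$ if $\mu(x)>\nu(x)$, and both equal to $0$ otherwise; put $\mathrm{Ind}_x(Q,P)=\mathrm{Ind}_x^+(Q,P)-\mathrm{Ind}_x^-(Q,P)$. For $a<b$ and $P,Q\neq0$, $\mathrm{Ind}_a^b(Q,P)=\mathrm{Ind}_a^+(Q,P)+\sum_{x\in(a,b)}\mathrm{Ind}_x(Q,P)-\mathrm{Ind}_b^-(Q,P)$ (only roots of $P$ in $(a,b)$ contribute). For $a>b$ and $P,Q\ne0$, $\mathrm{Ind}_a^b(Q,P)=-\mathrm{Ind}_b^a(Q,P)$. In every other case ($a=b$, or $P=0$, or $Q=0$), $\mathrm{Ind}_a^b(Q,P)=0$. *)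

(* Defs.v *)
From mathcomp Require Import all_boot all_order all_algebra.
From mathcomp Require Import boolp classical_sets functions cardinality fsbigop.

Set Implicit Arguments.
Unset Strict Implicit.
Unset Printing Implicit Defensive.

Import Order.TTheory GRing.Theory Num.Theory.
Local Open Scope classical_set_scope.
Local Open Scope ring_scope.

(* The constraint deg F <= n reads size F <= n.+1, and so holds for F = 0. *)
Definition IVT (R : realFieldType) (n : nat) : Prop :=
  forall F : {poly R}, (size F <= n.+1)%N ->
  forall a b : R, a < b -> F.[a] * F.[b] < 0 ->
  exists c : R, a < c < b /\ F.[c] = 0.

(* Var and Ind are half-integers; they are valued in rat. *)
Definition Var_at (R : realFieldType) (x : R) (P Q : {poly R}) : rat :=
  2^-1 * `|sgz P.[x] - sgz Q.[x]|%:~R.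

Definition Var (R : realFieldType) (a b : R) (P Q : {poly R}) : rat :=
  Var_at a P Q - Var_at b P Q.

Definition coXsubC (R : realFieldType) (x : R) (P : {poly R}) : {poly R} :=
  P %/ ('X - x%:P) ^+ mup x P.

Lemma coXsubCP (R : realFieldType) (x : R) (P : {poly R}) : P != 0 ->
  P = ('X - x%:P) ^+ mup x P * coXsubC x P /\ (coXsubC x P).[x] != 0.
Proof.
move=> P0; have dvdP : ('X - x%:P) ^+ mup x P %| P by rewrite -mup_geq.
have defP : P = ('X - x%:P) ^+ mup x P * coXsubC x P.
  by rewrite mulrC divpK.
split=> //; apply/negP => /eqP /rootP; rewrite -dvdp_XsubCl => dvdx.
have := ltnn (mup x P); rewrite mup_geq // {2}defP exprSr.
by rewrite dvdp_mul2l ?dvdx // expf_neq0 // polyXsubC_eq0.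
Qed.

(* The one-sided indices are meaningful for nonzero P and Q only.  The natural
   subtraction in Ind_minus is exact, since it occurs under the guard. *)
Definition Ind_plus (R : realFieldType) (x : R) (Q P : {poly R}) : rat :=
  if (mup x Q < mup x P)%N
  then 2^-1 * (sgz ((coXsubC x Q).[x] * (coXsubC x P).[x]))%:~R
  else 0.

Definition Ind_minus (R : realFieldType) (x : R) (Q P : {poly R}) : rat :=
  if (mup x Q < mup x P)%N
  then 2^-1 * (-1) ^+ (mup x P - mup x Q)
       * (sgz ((coXsubC x Q).[x] * (coXsubC x P).[x]))%:~R
  else 0.

Definition Ind_at (R : realFieldType) (x : R) (Q P : {poly R}) : rat :=
  Ind_plus x Q P - Ind_minus x Q P.

Lemma finite_Ind_at (R : realFieldType) (A : set R) (Q P : {poly R}) :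
  P != 0 -> finite_set (A `&` (fun x => Ind_at x Q P) @^-1` [set~ 0]).
Proof.
move=> P0; suff rootsub : forall n (p : {poly R}), (size p <= n)%N -> p != 0 ->
    finite_set [set x | root p x].
  apply: sub_finite_set (rootsub _ _ (leqnn (size P)) P0) => x [_ /= Ind0].
  apply/negPn/negP => /mupNroot muP; apply: Ind0.
  by rewrite /Ind_at /Ind_plus /Ind_minus muP ltn0 subrr.
elim=> [|n IHn] p; first by rewrite leqn0 size_poly_eq0 => ->.
move=> szp p0; case: (pselect (exists x, root p x)) => [[x px]|noroot]; last first.
  by apply: sub_finite_set (finite_set0 R) => x px; apply: noroot; exists x.
have [q def_p] := factor_theorem _ _ px.
have q0 : q != 0 by apply: contraNneq p0 => q0; rewrite def_p q0 mul0r.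
have szq : (size q <= n)%N.
  by move: szp; rewrite def_p size_Mmonic ?monicXsubC // size_XsubC addn2.
apply: sub_finite_set (_ : finite_set ([set y | root q y] `|` [set x])).
  by move=> y /=; rewrite def_p rootM root_XsubC => /orP[|/eqP ->]; [left|right].
by rewrite finite_setU; split; [exact: IHn|exact: finite_set1].
Qed.

(* By finite_Ind_at, the sum below is always a genuine finite sum. *)
Definition Ind_lt (R : realFieldType) (a b : R) (Q P : {poly R}) : rat :=
  Ind_plus a Q P + \sum_(x \in [set x : R | a < x < b]) Ind_at x Q P
  - Ind_minus b Q P.

Definition Ind (R : realFieldType) (a b : R) (Q P : {poly R}) : rat :=
  if (P == 0) || (Q == 0) then 0
  else if a < b then Ind_lt a b Q P
  else if b < a then - Ind_lt b a Q P
  else 0.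

(* Main.v *)
(* For nonzero P and Q, write s+(x) and s-(x) for the signs of PQ just to the
   right and just to the left of x. Without common roots,
   Ind+_x(Q,P) + Ind+_x(P,Q) = (s+(x) - sign PQ(x)) / 2, likewise for Ind- and
   s-, while Var_x(P,Q) = (1 - sign PQ(x)) / 2. Hence the claim says that the
   jumps s+ - s- at the roots of PQ in (a,b) telescope from s+(a) to s-(b),
   i.e. that s+ at a root equals s- at the next one. PQ may have degree 2d^2,
   beyond the available intermediate value property, so this is checked for P
   and Q separately: dividing out the roots at the two endpoints leaves a
   cofactor of no larger degree without roots on the closed interval. *)
Require Import Defs.
From mathcomp Require Import all_boot all_order all_algebra.
From mathcomp Require Import boolp classical_sets fsbigop.
From mathcomp Require Import lra.

Set Implicit Arguments.
Unset Strict Implicit.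

Import Order.TTheory GRing.Theory Num.Theory.
Local Open Scope ring_scope.

(** For [P] nonzero this is the sign of [P] just to the right of [x], where the extracted power of
    [X - x] is positive. On the left that power has sign [(-1) ^+ mup x P], whence the factor in
    [sign_left]. Reading these signs off the cofactor avoids any choice of neighbourhood, and
    multiplying those of [P] and [Q] gives those of [P * Q]. *)
Definition sign_right (R : realFieldType) (x : R) (P : {poly R}) : int :=
  sgz (coXsubC x P).[x].

Definition sign_left (R : realFieldType) (x : R) (P : {poly R}) : int :=
  (-1) ^+ mup x P * sgz (coXsubC x P).[x].

Lemma coXsubC_unique (R : realFieldType) (x : R) (G : {poly R}) (k : nat) :
  G.[x] != 0 ->
  mup x (('X - x%:P) ^+ k * G) = k /\ coXsubC x (('X - x%:P) ^+ k * G) = G.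
Proof.
move=> Gx; have mupE : mup x (('X - x%:P) ^+ k * G) = k.
  by rewrite mupMl // mup_XsubCX eqxx.
by split=> //; rewrite /coXsubC mupE mulKp // expf_neq0 // polyXsubC_eq0.
Qed.

Lemma mup_coXsubC_nonroot (R : realFieldType) (x : R) (P : {poly R}) :
  P.[x] != 0 -> mup x P = 0%N /\ coXsubC x P = P.
Proof. by move=> Px; have := coXsubC_unique 0 Px; rewrite expr0 mul1r. Qed.

Lemma mup_gt0_root (R : realFieldType) (x : R) (P : {poly R}) :
  P != 0 -> P.[x] = 0 -> (0 < mup x P)%N.
Proof. by move=> P0 /rootP; rewrite -dvdp_XsubCl XsubC_dvd. Qed.

Lemma IVT_same_sign (R : realFieldType) (n : nat) (a b : R) (P : {poly R}) :
  IVT R n -> (size P <= n.+1)%N -> a < b ->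
  (forall x, a <= x <= b -> P.[x] != 0) -> sgz P.[a] = sgz P.[b].
Proof.
move=> ivtR szP ltab nz.
have Pa : P.[a] != 0 by apply: nz; rewrite lexx ltW.
have Pb : P.[b] != 0 by apply: nz; rewrite lexx ltW.
have Pab : 0 < P.[a] * P.[b].
  rewrite lt_def mulf_neq0 //= leNgt; apply/negP => Pab.
  have [c [/andP[ac cb] /eqP]] := ivtR P szP a b ltab Pab.
  by apply/negP/nz; rewrite !ltW.
move: Pab; rewrite -sgz_gt0 sgzM.
by case: sgzP Pa => //; case: sgzP Pb.
Qed.

(** Write [P] as [(X - a)^m (X - b)^k G] with [G] free of roots on [[a, b]]. Since [G] divides [P],
    its size is within the reach of the hypothesis [IVT R n], so its sign is the same at both
    ends. *)
Lemma sign_right_left (R : realFieldType) (n : nat) (a b : R) (P : {poly R}) :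
  IVT R n -> (size P <= n.+1)%N -> P != 0 -> a < b ->
  (forall x, a < x < b -> P.[x] != 0) -> sign_right a P = sign_left b P.
Proof.
move=> ivtR szP P0 ltab nz.
have [defP P1a] := coXsubCP a P0.
set m := mup a P in defP; set P1 := coXsubC a P in defP P1a.
have P10 : P1 != 0 by apply: contraNneq P1a => ->; rewrite horner0.
have [defP1 Gb] := coXsubCP b P10.
set k := mup b P1 in defP1; set G := coXsubC b P1 in defP1 Gb.
have G0 : G != 0 by apply: contraNneq Gb => ->; rewrite horner0.
have Ga : G.[a] != 0.
  by apply: contraNneq P1a => Ga; rewrite defP1 hornerM Ga mulr0.
have defP' : P = ('X - b%:P) ^+ k * (('X - a%:P) ^+ m * G).
  by rewrite mulrCA -defP1.
have ba : 0 < b - a by rewrite subr_gt0.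
have nzb : (('X - a%:P) ^+ m * G).[b] != 0.
  by rewrite hornerM horner_exp hornerXsubC mulf_neq0 // expf_neq0 // gt_eqF.
have [mupb cob] := coXsubC_unique k nzb.
rewrite /sign_right /sign_left -/P1 defP' mupb cob defP1.
(* As [b - a] is positive, [(b - a)^m] has sign 1, while [(a - b)^k] has sign [(-1)^k], the very
   factor in [sign_left b P]. Only the signs of [G] at [a] and [b] remain. *)
rewrite !hornerM !horner_exp !hornerXsubC !sgzM !sgzX -(opprB b a) sgzN.
rewrite (gtr0_sgz ba) expr1n mul1r; congr (_ * _).
apply: IVT_same_sign ivtR _ ltab _ => [|x /andP[ax xb]].
  apply: leq_trans szP; apply: dvdp_leq => //.
  by rewrite defP' mulrA dvdp_mull.
(* The ends are [Ga] and [Gb]; strictly inside, a root of [G] would be a root of [P]. *)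
have [->//|xa] := eqVneq x a; have [->//|xnb] := eqVneq x b.
have : P.[x] != 0 by apply: nz; rewrite !lt_def xa ax eq_sym xnb xb.
by rewrite defP' !hornerM; apply: contraNneq => ->; rewrite !mulr0.
Qed.

Lemma roots_seq (R : idomainType) (P : {poly R}) :
  P != 0 -> exists s : seq R, forall x, root P x -> x \in s.
Proof.
have [n] := ubnP (size P); elim: n P => // n IHn P szP P0.
case: (pselect (exists x, root P x)) => [[x Px]|noroot]; last first.
  by exists [::] => x Px; case: noroot; exists x.
have [Q defP] := factor_theorem _ _ Px.
have Q0 : Q != 0 by apply: contraNneq P0 => Q0; rewrite defP Q0 mul0r.
have [|s sQ] := IHn Q _ Q0.
  by move: szP; rewrite defP size_Mmonic ?monicXsubC // size_XsubC addn2.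
exists (x :: s) => y; rewrite defP rootM root_XsubC inE.
by case/orP => [/sQ ->|->]; rewrite ?orbT.
Qed.

(** The list is ordered as a path from [a], so that an induction on it can move the left endpoint
    from one root to the next. *)
Lemma roots_between (R : realFieldType) (a b : R) (P : {poly R}) : P != 0 ->
  exists2 s : seq R, path <%R a s &
    forall x, (x \in s) = (a < x < b) && root P x.
Proof.
move=> P0; have [t sP] := roots_seq P0.
pose p := fun x => (a < x < b) && root P x.
exists (sort <=%R (undup (filter p t))) => [|x]; last first.
  rewrite mem_sort mem_undup mem_filter /p.
  by apply/andb_idr => /andP[_ /sP].
rewrite lt_path_sortedE sort_lt_sorted undup_uniq andbT.
apply/allP => x; rewrite mem_sort mem_undup mem_filter.
by move=> /andP[/andP[/andP[]]].
Qed.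

(** Induction on the list with [a] free: neither polynomial vanishes between [a] and the first root
    [r], so the sign right of [a] cancels the one left of [r]. What is left is the same claim from
    [r] on. *)
Lemma sum_sign_jumps (R : realFieldType) (n : nat) (a b : R) (P Q : {poly R})
    (s : seq R) :
  IVT R n -> (size P <= n.+1)%N -> (size Q <= n.+1)%N -> P != 0 -> Q != 0 ->
  a < b -> path <%R a s ->
  (forall x, (x \in s) = (a < x < b) && root (P * Q) x) ->
  sign_right a P * sign_right a Q
  + \sum_(x <- s) (sign_right x P * sign_right x Q
                   - sign_left x P * sign_left x Q)
  = sign_left b P * sign_left b Q.
Proof.
move=> ivtR szP szQ P0 Q0; elim: s a => [|r s IHs] a ltab; last first.
  move=> /= /andP[ar rs] mem_s.
  have rb : r < b by have := mem_s r; rewrite mem_head => /esym/andP[/andP[]].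
  have sgt : forall x, x \in s -> r < x.
    by move: rs; rewrite lt_path_sortedE => /andP[/allP].
  have nz : forall x, a < x < r -> ~~ root (P * Q) x.
    move=> x /andP[ax xr]; apply/negP => PQx.
    have : x \in r :: s by rewrite mem_s ax (lt_trans xr rb).
    by rewrite inE (lt_eqF xr) => /sgt; rewrite ltNge ltW.
  have [nzP nzQ] : (forall x, a < x < r -> P.[x] != 0)
                   /\ (forall x, a < x < r -> Q.[x] != 0).
    by split=> x /nz; rewrite rootM negb_or => /andP[].
  rewrite big_cons (@sign_right_left _ n a r P) //.
  rewrite (@sign_right_left _ n a r Q) //.
  rewrite addrA subrKC IHs // => x.
  have [rx|] := ltP r x.
    by have := mem_s x; rewrite inE (gt_eqF rx) (lt_trans ar rx).
  by move=> xr; apply: contraTF xr => /sgt; rewrite ltNge.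
move=> _ mem_s; rewrite big_nil addr0.
have nz : forall x, a < x < b -> ~~ root (P * Q) x.
  by move=> x axb; have := mem_s x; rewrite axb in_nil => /esym/negbT.
have [nzP nzQ] : (forall x, a < x < b -> P.[x] != 0)
                 /\ (forall x, a < x < b -> Q.[x] != 0).
  by split=> x /nz; rewrite rootM negb_or => /andP[].
by rewrite (sign_right_left ivtR szP P0 ltab nzP)
  (sign_right_left ivtR szQ Q0 ltab nzQ).
Qed.

(** At most one of [P], [Q] vanishes at [x], so at most one index is nonzero. If one does vanish,
    the sign of [P * Q] at [x] is 0; if neither does, the two signs on the right agree. *)
Lemma Ind_plus_sum (R : realFieldType) (x : R) (P Q : {poly R}) :
  P != 0 -> Q != 0 -> ~ (P.[x] = 0 /\ Q.[x] = 0) ->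
  Ind_plus x Q P + Ind_plus x P Q
  = 2^-1 * (sign_right x P * sign_right x Q - sgz (P * Q).[x])%:~R.
Proof.
move=> P0 Q0 nPQ; rewrite /Ind_plus /sign_right hornerM !sgzM.
have [Px|/mup_coXsubC_nonroot [-> ->]] := eqVneq P.[x] 0.
  have /mup_coXsubC_nonroot [-> ->] : Q.[x] != 0 by apply/eqP => Qx; apply: nPQ.
  rewrite (mup_gt0_root P0 Px) ltn0 addr0 Px sgz0 mul0r subr0.
  by rewrite [sgz Q.[x] * _]mulrC.
have [Qx|/mup_coXsubC_nonroot [-> ->]] := eqVneq Q.[x] 0.
  by rewrite (mup_gt0_root Q0 Qx) ltn0 add0r Qx sgz0 mulr0 subr0.
by rewrite ltnn addr0 subrr mulr0.
Qed.

Lemma Ind_minus_sum (R : realFieldType) (x : R) (P Q : {poly R}) :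
  P != 0 -> Q != 0 -> ~ (P.[x] = 0 /\ Q.[x] = 0) ->
  Ind_minus x Q P + Ind_minus x P Q
  = 2^-1 * (sign_left x P * sign_left x Q - sgz (P * Q).[x])%:~R.
Proof.
move=> P0 Q0 nPQ; rewrite /Ind_minus /sign_left hornerM !sgzM.
(* The power of -1 is rational in [Ind_minus] but an integer in [sign_left]. *)
have intrX k (z : int) : ((-1) ^+ k * z)%:~R = (-1) ^+ k * z%:~R :> rat.
  by rewrite intrM rmorphXn.
have [Px|/mup_coXsubC_nonroot [-> ->]] := eqVneq P.[x] 0.
  have /mup_coXsubC_nonroot [-> ->] : Q.[x] != 0 by apply/eqP => Qx; apply: nPQ.
  rewrite (mup_gt0_root P0 Px) ltn0 addr0 Px sgz0 mul0r subr0 subn0 expr0 mul1r.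
  by rewrite -!mulrA [sgz Q.[x] * _]mulrC intrX.
have [Qx|/mup_coXsubC_nonroot [-> ->]] := eqVneq Q.[x] 0.
  rewrite (mup_gt0_root Q0 Qx) ltn0 add0r Qx sgz0 mulr0 subr0 subn0 expr0 mul1r.
  by rewrite -!mulrA [sgz P.[x] * _]mulrCA intrX.
by rewrite ltnn expr0 !mul1r addr0 subrr mulr0.
Qed.

Lemma Ind_at_sum (R : realFieldType) (x : R) (P Q : {poly R}) :
  P != 0 -> Q != 0 -> ~ (P.[x] = 0 /\ Q.[x] = 0) ->
  Ind_at x Q P + Ind_at x P Q
  = 2^-1 * (sign_right x P * sign_right x Q
            - sign_left x P * sign_left x Q)%:~R.
Proof.
move=> P0 Q0 nPQ; have := Ind_plus_sum P0 Q0 nPQ.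
have := Ind_minus_sum P0 Q0 nPQ; rewrite /Ind_at !intrB; lra.
Qed.

(** For [s], [t] in {-1, 0, 1}, [|s - t| = 1 - s t] unless both are 0. *)
Lemma Var_at_coprime (R : realFieldType) (x : R) (P Q : {poly R}) :
  ~ (P.[x] = 0 /\ Q.[x] = 0) ->
  Var_at x P Q = 2^-1 * (1 - sgz (P * Q).[x])%:~R.
Proof.
move=> nPQ; rewrite /Var_at hornerM sgzM; congr (_ * _%:~R).
by case: (sgzP P.[x]) nPQ; case: (sgzP Q.[x]) => // -> -> [].
Qed.

(** The list may contain more than the roots of [P], as other points contribute 0. Hence the roots
    of [P * Q] can index both sums of the theorem. *)
Lemma sum_Ind_at_seq (R : realFieldType) (a b : R) (P Q : {poly R})
    (s : seq R) : uniq s ->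
  (forall x, x \in s -> a < x < b) ->
  (forall x, a < x < b -> root P x -> x \in s) ->
  \sum_(x \in [set x : R | a < x < b]%classic) Ind_at x Q P
  = \sum_(x <- s) Ind_at x Q P.
Proof.
move=> uniq_s s_ab ab_s; rewrite [RHS]fsbig_seq //; symmetry.
apply: fsbig_widen.
  by move=> x /= /s_ab.
move=> x [/= axb xs]; rewrite /Ind_at /Ind_plus /Ind_minus.
have /mupNroot -> : ~~ root P x by apply/negP => /(ab_s _ axb).
by rewrite ltn0 subrr.
Qed.

Lemma Ind_lt_sum (R : realFieldType) (n : nat) (a b : R) (P Q : {poly R}) :
  IVT R n -> (size P <= n.+1)%N -> (size Q <= n.+1)%N -> P != 0 -> Q != 0 ->
  a < b -> (forall x, a <= x <= b -> ~ (P.[x] = 0 /\ Q.[x] = 0)) ->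
  Ind_lt a b Q P + Ind_lt a b P Q = Var a b P Q.
Proof.
move=> ivtR szP szQ P0 Q0 ltab nPQ.
have [s path_s mem_s] := roots_between a b (mulf_neq0 P0 Q0).
have uniq_s : uniq s.
  by apply: lt_sorted_uniq; move: path_s => /path_sorted.
have s_ab x : x \in s -> a < x < b by rewrite mem_s => /andP[].
have na : ~ (P.[a] = 0 /\ Q.[a] = 0) by apply: nPQ; rewrite lexx ltW.
have nb : ~ (P.[b] = 0 /\ Q.[b] = 0) by apply: nPQ; rewrite lexx ltW.
have sumI : \sum_(x <- s) Ind_at x Q P + \sum_(x <- s) Ind_at x P Q
  = 2^-1 * (\sum_(x <- s) (sign_right x P * sign_right x Q
                           - sign_left x P * sign_left x Q))%:~R.
  rewrite -big_split /= raddf_sum /= mulr_sumr.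
  apply: eq_big_seq => x /s_ab /andP[ax xb].
  by apply: Ind_at_sum => //; apply: nPQ; rewrite !ltW.
have := sum_sign_jumps ivtR szP szQ P0 Q0 ltab path_s mem_s.
move/(congr1 (fun z : int => z%:~R : rat)); rewrite intrD => jumps.
rewrite /Var !Var_at_coprime // /Ind_lt.
rewrite !(@sum_Ind_at_seq _ a b _ _ s) //; last 2 first.
- by move=> x axb Px; rewrite mem_s axb rootM Px orbT.
- by move=> x axb Px; rewrite mem_s axb rootM Px.
(* The one-sided signs at [a] and [b] cancel against the sum of jumps; the signs of [P * Q] at the
   two ends make up [Var]. *)
have := Ind_plus_sum P0 Q0 na; have := Ind_minus_sum P0 Q0 nb.
rewrite !intrB; move: sumI jumps; lra.
Qed.

(** Matches the convention that the index is 0 for a zero polynomial: each end contributes 1/2 and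
    the difference vanishes. *)
Lemma Var_left0 (R : realFieldType) (a b : R) (Q : {poly R}) :
  Q.[a] != 0 -> Q.[b] != 0 -> Var a b 0 Q = 0.
Proof.
move=> Qa Qb; rewrite /Var !Var_at_coprime; try by move=> [_ /eqP]; apply/negP.
by rewrite mul0r !horner0 subrr.
Qed.

Lemma Var_sym (R : realFieldType) (a b : R) (P Q : {poly R}) :
  Var a b P Q = Var a b Q P.
Proof. by rewrite /Var /Var_at distrC [in X in _ - X]distrC. Qed.

Theorem proposition18 (d : nat) (hd : (2 <= d)%N)
    (R : realFieldType) (hR : IVT R (d ^ 2)%N)
    (a b : R) (P Q : {poly R})
    (hP : (size P <= (d ^ 2).+1)%N) (hQ : (size Q <= (d ^ 2).+1)%N)
    (hPQ : forall x : R, Num.min a b <= x <= Num.max a b ->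
             ~ (P.[x] = 0 /\ Q.[x] = 0)) :
  Ind a b Q P + Ind a b P Q = Var a b P Q.
Proof.
have na : ~ (P.[a] = 0 /\ Q.[a] = 0).
  by apply: hPQ; rewrite ge_min le_max lexx.
have nb : ~ (P.[b] = 0 /\ Q.[b] = 0).
  by apply: hPQ; rewrite ge_min le_max lexx !orbT.
rewrite /Ind [(Q == 0) || _]orbC.
have [P0|P0] := eqVneq P 0.
  rewrite /= addr0 P0 Var_left0 //; apply/eqP => Q0.
    by apply: na; rewrite P0 horner0.
  by apply: nb; rewrite P0 horner0.
have [Q0|Q0] := eqVneq Q 0.
  rewrite /= addr0 Q0 Var_sym Var_left0 //; apply/eqP => Px.
    by apply: na; rewrite Q0 horner0.
  by apply: nb; rewrite Q0 horner0.
rewrite /=; case: ltgtP hPQ => [ltab|ltba|->] nPQ.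
- exact: Ind_lt_sum hR hP hQ P0 Q0 ltab nPQ.
(* Exchanging the ends negates both sides. *)
- by rewrite -opprD (Ind_lt_sum hR hP hQ P0 Q0 ltba nPQ) /Var opprB.
- by rewrite addr0 /Var subrr.
Qed.
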